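(* Let $G:\mathbb{R}^{N+1}\to\mathbb{R}^N$ be continuously differentiable, and let $(u_0,\lambda_0)\in\mathbb{R}^N\times\mathbb{R}$ be a solution of $G(u,\lambda)=0$. Let $u_N$ be a left singular vector of $G_u(u_0,\lambda_0)$ associated with its smallest singular value $\sigma_N$. Then $(u_0,\lambda_0)$ is a simple fold, i.e. $\dim(\mathrm{Ker}(G_u(u_0,\lambda_0)))=1$ and $G_\lambda(u_0,\lambda_0)\notin \mathrm{Range}(G_u(u_0,\lambda_0))$, if and only if $\dim(\mathrm{Ker}(G_u(u_0,\lambda_0)))=1$ and $u_N^TG_\lambda(u_0,\lambda_0)\neq 0$.
   Context: $G_u=\partial G/\partial u$ is the $N\times N$ Jacobian of $G$ with respect to $u\in\mathbb{R}^N$, and $G_\lambda=\partial G/\partial\lambda\in\mathbb{R}^N$ is the derivative with respect to the scalar parameter $\lambda$. Let $G_u(u_0,\lambda_0)=U\Sigma V^T$ be a singular value decomposition with $\Sigma=\mathrm{diag}(\sigma_1,\dots,\sigma_N)$, $\sigma_1\ge\sigma_2\ge\dots\ge\sigma_N\ge 0$. The left singular vector $u_N=Ue_N$ is the last column of $U$ (a unit vector), where $e_N$ is the last column of the $N\times N$ identity matrix. *)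

(* Defs.v *)
From mathcomp Require Import all_boot all_order all_algebra.
From mathcomp Require Import all_classical all_reals all_analysis.

Set Implicit Arguments.
Unset Strict Implicit.
Unset Printing Implicit Defensive.

Import Order.TTheory GRing.Theory Num.Theory.
Import numFieldNormedType.Exports.

Local Open Scope ring_scope.
Local Open Scope classical_set_scope.

(* [G] takes and returns row vectors, because the library Jacobian ['J f x] is
   defined for row vectors: its rows are indexed by the input variables and its
   columns by the output components. The transposes below yield the usual
   matrix (dG_i/du_j)_(i,j) and column vector (dG_i/dlambda)_i, so that all the
   linear algebra is done on column vectors. *)
Definition G_u (R : realType) (N : nat) (G : 'rV[R]_N * R^o -> 'rV[R]_N)
    (u : 'rV[R]_N) (lambda : R) : 'M[R]_N :=
  ('J (fun v : 'rV[R]_N => G (v, lambda)) u)^T.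

Definition G_lambda (R : realType) (N : nat) (G : 'rV[R]_N * R^o -> 'rV[R]_N)
    (u : 'rV[R]_N) (lambda : R) : 'cV[R]_N :=
  (derive1 (fun t : R => G (u, t)) lambda)^T.

(* Together, [G_u] and [G_lambda] are the blocks of the Jacobian of [G] on
   R^(N+1), so their continuity is that of the differential of [G]. *)
Definition continuously_differentiable (R : realType) (N : nat)
    (G : 'rV[R]_N * R^o -> 'rV[R]_N) : Prop :=
  [/\ forall p, differentiable G p,
      continuous (fun p : 'rV[R]_N * R^o => G_u G p.1 p.2)
    & continuous (fun p : 'rV[R]_N * R^o => G_lambda G p.1 p.2)].

Definition is_svd (R : realType) (N : nat)
    (A U : 'M[R]_N) (sigma : 'rV[R]_N) (V : 'M[R]_N) : Prop :=
  [/\ U^T *m U = 1%:M,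
      V^T *m V = 1%:M,
      forall i, 0 <= sigma 0 i,
      forall i j : 'I_N, (i <= j)%N -> sigma 0 j <= sigma 0 i
    & A = U *m diag_mx sigma *m V^T].

(* Kernel and range of the linear map x |-> A x on column vectors; the matrix
   operations [kermx] and [<=%MS] refer to x |-> x A on row vectors instead. *)
Definition Ker (R : realType) (N : nat) (A : 'M[R]_N) : {vspace 'cV[R]_N} :=
  lker (linfun (mulmx A : 'cV[R]_N -> 'cV[R]_N)).

Definition Range (R : realType) (N : nat) (A : 'M[R]_N) : {vspace 'cV[R]_N} :=
  limg (linfun (mulmx A : 'cV[R]_N -> 'cV[R]_N)).

Definition simple_fold (R : realType) (N : nat)
    (G : 'rV[R]_N * R^o -> 'rV[R]_N) (u : 'rV[R]_N) (lambda : R) : Prop :=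
  \dim (Ker (G_u G u lambda)) = 1%N /\
  G_lambda G u lambda \notin Range (G_u G u lambda).

(* Main.v *)
Require Import Defs.
From mathcomp Require Import all_boot all_order all_algebra.
From mathcomp Require Import all_classical all_reals all_analysis.

Import Order.TTheory GRing.Theory Num.Theory.
Import numFieldNormedType.Exports.

Local Open Scope ring_scope.

(** Write A = G_u(u0, lambda0). When Ker A is a line, A is singular, so its
    smallest singular value is 0 and the corresponding left singular vector
    satisfies u_N^T A = sigma_N v_N^T = 0 ([left_singular_mulmx]). Hence Range A
    lies in the hyperplane orthogonal to u_N. By rank-nullity both spaces have
    dimension N - 1, so they coincide ([Range_orthogonal]): a vector b, here
    G_lambda(u0, lambda0), is outside Range A exactly when u_N^T b <> 0. *)

Set Implicit Arguments.
Unset Strict Implicit.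

Lemma mem_Ker (R : realType) (N : nat) (A : 'M[R]_N) (x : 'cV[R]_N) :
  (x \in Ker A) = (A *m x == 0).
Proof. by rewrite memv_ker lfunE. Qed.

Lemma dim_Ker_Range (R : realType) (N : nat) (A : 'M[R]_N) :
  (\dim (Ker A) + \dim (Range A))%N = N.
Proof.
have := limg_ker_dim (linfun (mulmx A : 'cV[R]_N -> 'cV[R]_N)) fullv.
by rewrite capfv dimvf /dim /= muln1.
Qed.

(** The singular values are sorted, so if the last one is nonzero then all are,
    and A is a product of three injective maps. *)
Lemma last_singular_value_eq0 (R : realType) (n : nat)
    (A U V : 'M[R]_n.+1) (sigma : 'rV[R]_n.+1) :
  is_svd A U sigma V -> (0 < \dim (Ker A))%N -> sigma 0 ord_max = 0.
Proof.
case=> UU VV sigma_ge0 sigma_sorted ->; apply: contraTeq => sigmaN_neq0.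
rewrite -eqn0Ngt dimv_eq0 -subv0; apply/subvP => x.
rewrite mem_Ker memv0 => /eqP Ax0.
have sigma_neq0 i : sigma 0 i != 0.
  apply: lt0r_neq0; apply: lt_le_trans (sigma_sorted i ord_max (leq_ord i)).
  by rewrite lt_def sigmaN_neq0 sigma_ge0.
have DVx0 : diag_mx sigma *m (V^T *m x) = 0.
  rewrite -!mulmxA in Ax0.
  by rewrite -[LHS]mul1mx -UU -mulmxA Ax0 mulmx0.
have Vx0 : V^T *m x = 0.
  apply/matrixP=> i j; move/matrixP/(_ i j)/eqP: DVx0.
  by rewrite mul_diag_mx !mxE mulf_eq0 (negPf (sigma_neq0 i)) => /eqP.
by rewrite -[x]mul1mx -(mulmx1C VV) -mulmxA Vx0 mulmx0.
Qed.

Lemma left_singular_mulmx (R : realType) (N : nat)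
    (A U V : 'M[R]_N) (sigma : 'rV[R]_N) (i : 'I_N) :
  is_svd A U sigma V -> (col i U)^T *m A = sigma 0 i *: (col i V)^T.
Proof.
case=> UU _ _ _ ->.
by rewrite tr_col -row_mul !mulmxA UU mul1mx row_mul row_diag_mx -scalemxAl
           -rowE tr_col.
Qed.

Lemma left_singular_unit (R : realType) (N : nat)
    (A U V : 'M[R]_N) (sigma : 'rV[R]_N) (i : 'I_N) :
  is_svd A U sigma V -> (col i U)^T *m col i U = 1%:M.
Proof.
case=> UU _ _ _ _.
apply/matrixP=> j k; rewrite !ord1.
move/matrixP/(_ i i): UU; rewrite !mxE !eqxx => <-.
by apply: eq_bigr => l _; rewrite !mxE.
Qed.

(** The dimension of the hyperplane {x | w^T x = 0} is at most N - 1 because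
    w^T w = 1, so it cannot exceed its subspace Range A of dimension N - 1. *)
Lemma Range_orthogonal (R : realType) (n : nat)
    (A U V : 'M[R]_n.+1) (sigma : 'rV[R]_n.+1) (b : 'cV[R]_n.+1) :
  is_svd A U sigma V -> \dim (Ker A) = 1%N ->
  (b \in Range A) = (((col ord_max U)^T *m b) 0 0 == 0).
Proof.
move=> svdA dimK; set w := col ord_max U.
have wA0 : w^T *m A = 0.
  by rewrite (left_singular_mulmx _ svdA)
             (last_singular_value_eq0 svdA) ?dimK ?scale0r.
pose phi : 'Hom('cV[R]_n.+1, 'M[R]_1) := linfun (mulmx w^T).
have sub_Range : (Range A <= lker phi)%VS.
  apply/subvP=> _ /memv_imgP[x _ ->].
  by rewrite memv_ker !lfunE /= mulmxA wA0 mul0mx.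
have dim_img : (0 < \dim (limg phi))%N.
  rewrite lt0n dimv_eq0; apply/negP => /eqP img0.
  have := memv_img phi (memvf w).
  rewrite img0 memv0 lfunE /= (left_singular_unit _ svdA).
  by rewrite oner_eq0.
have -> : Range A = lker phi.
  apply/eqP; rewrite eqEdim sub_Range /=.
  have := limg_ker_dim phi fullv; rewrite capfv dimvf /dim /= muln1 => dim_phi.
  have := dim_Ker_Range A; rewrite dimK add1n => -[->].
  by rewrite -ltnS -[X in (_ < X)%N]dim_phi -[X in (X < _)%N]addn0 ltn_add2l.
rewrite memv_ker lfunE /=; apply/eqP/eqP => [-> | wb0]; first by rewrite mxE.
by apply/matrixP=> i j; rewrite !ord1 wb0 mxE.
Qed.

Unset Implicit Arguments.
Set Strict Implicit.

(* N = n.+1: the smallest singular value exists only when N >= 1 *)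
Theorem mainTheorem1 (R : realType) (n : nat)
    (G : 'rV[R]_n.+1 * R^o -> 'rV[R]_n.+1)
    (u0 : 'rV[R]_n.+1) (lambda0 : R)
    (U V : 'M[R]_n.+1) (sigma : 'rV[R]_n.+1) (u_N : 'cV[R]_n.+1) :
  continuously_differentiable G ->
  G (u0, lambda0) = 0 ->
  is_svd (G_u G u0 lambda0) U sigma V ->
  u_N = col ord_max U ->
  simple_fold G u0 lambda0 <->
    \dim (Ker (G_u G u0 lambda0)) = 1%N /\
    (u_N^T *m G_lambda G u0 lambda0) 0 0 != 0.
Proof.
move=> _ _ svdA ->.
by split=> -[dimK b_out]; split=> //; move: b_out;
  rewrite (Range_orthogonal _ svdA dimK).
Qed.
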